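(* Let $A,B\in\mathbb{R}^{n\times n}$, $a,b\in\mathbb{R}^n$, $\eta>0$, and let $K=\{u\in\mathbb{R}^n: Mu=d,\ 0\le u\le c\}$ be nonempty, where $M$ is a real matrix with $n$ columns, $d$ is a real vector of matching dimension, $c\in\mathbb{R}^n$, and the inequalities are componentwise. Let $$R_\eta(x)=Ax+a-P_K\big((A-\eta B)x+a-\eta b\big),\qquad x\in\mathbb{R}^n,$$ and set $$L_R:=\|A\|+\|A-\eta B\|,\qquad \mu_R:=\tfrac12\Big(\lambda_{\min}\big(\operatorname{sym}(A+\eta B)\big)-\|A-\eta B\|\Big).$$ Then: (i) $\|R_\eta(x)-R_\eta(y)\|\le L_R\|x-y\|$ for all $x,y\in\mathbb{R}^n$. (ii) $\langle R_\eta(x)-R_\eta(y),x-y\rangle\ge \mu_R\|x-y\|^2$ for all $x,y\in\mathbb{R}^n$. In particular, if $\lambda_{\min}(\operatorname{sym}(A+\eta B))\ge\|A-\eta B\|$, then $R_\eta$ is monotone. (iii) If $\lambda_{\min}(\operatorname{sym}(A+\eta B))>\|A-\eta B\|$, then $\mu_R>0$, $R_\eta$ is strongly monotone, and $$\langle R_\eta(x)-R_\eta(y),x-y\rangle\ge \frac{\mu_R}{L_R^2}\|R_\eta(x)-R_\eta(y)\|^2\qquad\text{for all }x,y\in\mathbb{R}^n.$$ If, in addition, $X^*=\{x\in\mathbb{R}^n:R_\eta(x)=0\}$ is nonempty and closed, then $R_\eta$ has a unique zero $x^*$, and for all $x\in\mathbb{R}^n$, $$\langle R_\eta(x),x-x^*\rangle\ge\mu_R\|x-x^*\|^2\quad\text{and}\quad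 \langle R_\eta(x),x-x^*\rangle\ge\beta_R\|R_\eta(x)\|^2,$$ where $$\beta_R=\frac{\lambda_{\min}(\operatorname{sym}(A+\eta B))-\|A-\eta B\|}{2\,(\|A\|+\|A-\eta B\|)^2}.$$
   Context: $\langle\cdot,\cdot\rangle$ is the Euclidean inner product; $\|\cdot\|$ is the Euclidean norm on vectors and the induced (spectral) operator norm on matrices. $P_K$ is the Euclidean projection onto the closed convex set $K$. For a square matrix $C$, $\operatorname{sym}(C)=(C+C^\top)/2$, and $\lambda_{\min}$ denotes the smallest eigenvalue of a symmetric matrix. A map $R:\mathbb{R}^n\to\mathbb{R}^n$ is monotone if $\langle R(x)-R(y),x-y\rangle\ge0$ for all $x,y$, and strongly monotone if for some $\mu>0$, $\langle R(x)-R(y),x-y\rangle\ge\mu\|x-y\|^2$ for all $x,y$. ($R_\eta$ is the projection residual $H(x)-P_K(H(x)-\eta Q(x))$ of the general variational inequality with affine maps $H(x)=Ax+a$, $Q(x)=Bx+b$.) *)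

(* Defs.v *)
From HB Require Import structures.
From mathcomp Require Import all_boot all_order all_algebra.
From mathcomp Require Import all_classical all_reals all_analysis.

Set Implicit Arguments.
Unset Strict Implicit.
Unset Printing Implicit Defensive.

Import Order.TTheory GRing.Theory Num.Theory.
Import numFieldNormedType.Exports.

Local Open Scope classical_set_scope.
Local Open Scope ring_scope.

Definition dotv (R : realType) (n : nat) (u v : 'cV[R]_n) : R :=
  \sum_(i < n) u i 0 * v i 0.

(* The library norm `|u| on matrices is the max norm, hence this one. *)
Definition norm2 (R : realType) (n : nat) (u : 'cV[R]_n) : R :=
  Num.sqrt (dotv u u).

Definition opnorm2 (R : realType) (m n : nat) (C : 'M[R]_(m, n)) : R :=
  sup [set norm2 (C *m v) | v in [set v : 'cV[R]_n | norm2 v <= 1]].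

Definition symmx (R : realType) (n : nat) (C : 'M[R]_n) : 'M[R]_n :=
  2^-1 *: (C + C^T).

(* For symmetric C of positive size the set of eigenvalues is finite and
   nonempty, so the infimum is the smallest eigenvalue. For n = 0 there are no
   eigenvalues and the value is the convention inf set0 = 0. *)
Definition lambda_min (R : realType) (n : nat) (C : 'M[R]_n) : R :=
  inf [set l : R | eigenvalue C l].

Definition is_proj (R : realType) (n : nat) (K : set 'cV[R]_n)
    (z p : 'cV[R]_n) : Prop :=
  K p /\ forall q, K q -> norm2 (z - p) <= norm2 (z - q).

(* The default value 0 is only taken when z has no nearest point in K, which
   cannot happen for nonempty closed convex K. *)
Definition proj (R : realType) (n : nat) (K : set 'cV[R]_n)
    (z : 'cV[R]_n) : 'cV[R]_n :=
  xget 0 [set p | is_proj K z p].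

Definition box_affine_set (R : realType) (m n : nat)
    (M : 'M[R]_(m, n)) (d : 'cV[R]_m) (c : 'cV[R]_n) : set 'cV[R]_n :=
  [set u | M *m u = d /\ forall i, 0 <= u i 0 <= c i 0].

Definition residual (R : realType) (n : nat) (A B : 'M[R]_n)
    (a b : 'cV[R]_n) (eta : R) (K : set 'cV[R]_n)
    (x : 'cV[R]_n) : 'cV[R]_n :=
  A *m x + a - proj K ((A - eta *: B) *m x + a - eta *: b).

Definition monotone_map (R : realType) (n : nat)
    (F : 'cV[R]_n -> 'cV[R]_n) : Prop :=
  forall x y, 0 <= dotv (F x - F y) (x - y).

Definition strongly_monotone_map (R : realType) (n : nat)
    (F : 'cV[R]_n -> 'cV[R]_n) : Prop :=
  exists2 mu : R, 0 < mu &
    forall x y, mu * norm2 (x - y) ^+ 2 <= dotv (F x - F y) (x - y).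

(* Main.v *)
Require Import Defs.
From HB Require Import structures.
From mathcomp Require Import all_boot all_order all_algebra.
From mathcomp Require Import all_classical all_reals all_analysis.
From mathcomp Require Import ring lra.

Set Implicit Arguments.
Unset Strict Implicit.
Unset Printing Implicit Defensive.

Import Order.TTheory GRing.Theory Num.Theory.
Import numFieldNormedType.Exports.

Local Open Scope classical_set_scope.
Local Open Scope ring_scope.

(** The residual is F(x) = A x + a - P(z(x)), where P is the projection onto the
    constraint set and z(x) is affine with linear part A - eta B. For h = x - y
    put w = (A - eta B) h and let p = P(z(x)) - P(z(y)), so that
    F(x) - F(y) = A h - p. Bars denote the Euclidean and the spectral norm.
    Everything rests on the firm nonexpansiveness
    |p|^2 <= <p, w> of P (proj_firmly_nonexpansive).

    The Lipschitz bound follows from |p| <= |w|. For monotonicity, firm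
    nonexpansiveness is used as |2 p - w| <= |w|, which gives
    <p, h> <= (<w, h> + |w| |h|) / 2 (firm_dotv_le). Hence
    <F(x) - F(y), h> >= (<(A + eta B) h, h> - |A - eta B| |h|^2) / 2, and the
    quadratic form of A + eta B is that of its symmetric part, which is at least
    lambda_min |h|^2 (lambda_min_symmx). Cocoercivity and the estimates at the
    zero combine the two bounds; the zero is unique by strong monotonicity.

    Two facts support this. A nearest point exists because the constraint set is
    closed in a compact box (box_affine_proj_exists), so that P satisfies the
    variational inequality of a projection. And the infimum of the Rayleigh
    quotient of a symmetric matrix is an eigenvalue, because a positive
    semidefinite matrix that is invertible is bounded below
    (lambda_min_rayleigh). *)

(** * The Euclidean inner product and norm *)

Lemma dotvC (R : realType) n (u v : 'cV[R]_n) : dotv u v = dotv v u.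
Proof. by apply: eq_bigr => i _; rewrite mulrC. Qed.

Lemma dotvDl (R : realType) n (u v w : 'cV[R]_n) :
  dotv (u + v) w = dotv u w + dotv v w.
Proof. by rewrite -big_split; apply: eq_bigr => i _; rewrite mxE mulrDl. Qed.

Lemma dotvZl (R : realType) n (k : R) (u v : 'cV[R]_n) :
  dotv (k *: u) v = k * dotv u v.
Proof. by rewrite mulr_sumr; apply: eq_bigr => i _; rewrite mxE mulrA. Qed.

Lemma dotvNl (R : realType) n (u v : 'cV[R]_n) : dotv (- u) v = - dotv u v.
Proof. by rewrite -scaleN1r dotvZl mulN1r. Qed.

Lemma dotvDr (R : realType) n (u v w : 'cV[R]_n) :
  dotv w (u + v) = dotv w u + dotv w v.
Proof. by rewrite !(dotvC w) dotvDl. Qed.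

Lemma dotvZr (R : realType) n (k : R) (u v : 'cV[R]_n) :
  dotv v (k *: u) = k * dotv v u.
Proof. by rewrite !(dotvC v) dotvZl. Qed.

Lemma dotvNr (R : realType) n (u v : 'cV[R]_n) : dotv v (- u) = - dotv v u.
Proof. by rewrite !(dotvC v) dotvNl. Qed.

Lemma dotv0 (R : realType) n (u : 'cV[R]_n) : dotv u 0 = 0.
Proof. by rewrite -(scale0r 0) dotvZr mul0r. Qed.

Definition dotv_lin := (dotvDl, dotvDr, dotvNl, dotvNr, dotvZl, dotvZr).

Lemma dotv_trmx (R : realType) m n (C : 'M[R]_(m, n)) (u : 'cV[R]_n)
    (v : 'cV[R]_m) : dotv (C *m u) v = dotv u (C^T *m v).
Proof.
have dotvE k (x y : 'cV[R]_k) : dotv x y = (x^T *m y) 0 0.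
  by rewrite mxE; apply: eq_bigr => i _; rewrite mxE.
by rewrite !dotvE trmx_mul mulmxA.
Qed.

Lemma dotv_ge0 (R : realType) n (u : 'cV[R]_n) : 0 <= dotv u u.
Proof. by apply: sumr_ge0 => i _; rewrite -expr2 sqr_ge0. Qed.

Lemma dotv_eq0 (R : realType) n (u : 'cV[R]_n) : (dotv u u == 0) = (u == 0).
Proof.
apply/idP/eqP => [|->]; last by rewrite dotv0.
rewrite psumr_eq0 => [/allP u0|i _]; last by rewrite -expr2 sqr_ge0.
apply/colP => i; rewrite mxE; apply/eqP.
by have := u0 i (mem_index_enum i); rewrite /= mulf_eq0 orbb.
Qed.

Lemma norm2_ge0 (R : realType) n (u : 'cV[R]_n) : 0 <= norm2 u.
Proof. exact: sqrtr_ge0. Qed.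

Lemma norm2_sqr (R : realType) n (u : 'cV[R]_n) : norm2 u ^+ 2 = dotv u u.
Proof. by rewrite sqr_sqrtr ?dotv_ge0. Qed.

Lemma norm2_eq0 (R : realType) n (u : 'cV[R]_n) : (norm2 u == 0) = (u == 0).
Proof. by rewrite -dotv_eq0 -norm2_sqr sqrf_eq0. Qed.

Lemma norm20 (R : realType) n : norm2 (0 : 'cV[R]_n) = 0.
Proof. by apply/eqP; rewrite norm2_eq0. Qed.

Lemma norm2Z (R : realType) n (k : R) (u : 'cV[R]_n) :
  norm2 (k *: u) = `|k| * norm2 u.
Proof.
by rewrite /norm2 !dotv_lin mulrA -expr2 sqrtrM ?sqr_ge0 // sqrtr_sqr.
Qed.

(** The discriminant of the nonnegative quadratic t |-> <C (u + t v), u + t v>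
    is nonpositive. Semidefiniteness is all that is known of C minus the infimum
    of its Rayleigh quotient, to which this is applied below. *)
Lemma psd_cauchy_schwarz (R : realType) n (C : 'M[R]_n) (u v : 'cV[R]_n) :
    C^T = C -> (forall w, 0 <= dotv (C *m w) w) ->
  dotv (C *m u) v ^+ 2 <= dotv (C *m u) u * dotv (C *m v) v.
Proof.
move=> Csym Cpsd; have Cvu : dotv (C *m v) u = dotv (C *m u) v.
  by rewrite dotv_trmx Csym dotvC.
have quad t : 0 <= dotv (C *m u) u + 2 * t * dotv (C *m u) v
                   + t ^+ 2 * dotv (C *m v) v.
  have := Cpsd (u + t *: v).
  by rewrite mulmxDr -scalemxAr !dotv_lin Cvu; congr (_ <= _); ring.
have := Cpsd v; move: (dotv (C *m v) v) quad => q quad.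
move: (dotv (C *m u) u) (dotv (C *m u) v) quad => p r quad q_ge0.
have [q0|q_neq0] := eqVneq q 0.
  rewrite q0 mulr0; have [->|r_neq0] := eqVneq r 0; first by rewrite expr0n.
  (* The quadratic is affine in t; at this t it takes the value -1. *)
  have := quad (- (p + 1) / (2 * r)); rewrite q0.
  have -> : p + 2 * (- (p + 1) / (2 * r)) * r + (- (p + 1) / (2 * r)) ^+ 2 * 0
            = -1 by field.
  lra.
have q_gt0 : 0 < q by rewrite lt_neqAle eq_sym q_neq0.
(* The minimum of the quadratic. *)
have := quad (- r / q).
have -> : p + 2 * (- r / q) * r + (- r / q) ^+ 2 * q = (p * q - r ^+ 2) / q.
  by field.
by rewrite pmulr_lge0 ?invr_gt0 // subr_ge0.
Qed.

Lemma cauchy_schwarz (R : realType) n (u v : 'cV[R]_n) :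
  dotv u v <= norm2 u * norm2 v.
Proof.
have := @psd_cauchy_schwarz R n 1%:M u v (trmx1 _ _).
rewrite !mul1mx => /(_ (fun w => _)) CS.
have {}CS : dotv u v ^+ 2 <= dotv u u * dotv v v.
  by apply: CS => w; rewrite mul1mx dotv_ge0.
apply: le_trans (ler_norm _) _.
by rewrite -sqrtr_sqr /norm2 -sqrtrM ?dotv_ge0 // ler_wsqrtr.
Qed.

Lemma norm2_triangle (R : realType) n (u v : 'cV[R]_n) :
  norm2 (u + v) <= norm2 u + norm2 v.
Proof.
rewrite -(@ler_pXn2r _ 2) ?nnegrE ?addr_ge0 ?norm2_ge0 //.
rewrite norm2_sqr !dotv_lin -!norm2_sqr (dotvC v).
have := cauchy_schwarz u v; nra.
Qed.

Lemma norm2N (R : realType) n (u : 'cV[R]_n) : norm2 (- u) = norm2 u.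
Proof. by rewrite -scaleN1r norm2Z normrN1 mul1r. Qed.

(** * The spectral norm *)

(** Row-wise Cauchy-Schwarz bounds C by its Frobenius norm, so the set whose
    supremum defines the spectral norm is bounded. *)
Lemma opnorm2_has_ubound (R : realType) m n (C : 'M[R]_(m, n)) :
  has_ubound [set norm2 (C *m v) | v in [set v : 'cV[R]_n | norm2 v <= 1]].
Proof.
exists (Num.sqrt (\sum_i norm2 (row i C)^T ^+ 2)) => _ [v /= v_le1 <-].
rewrite ler_wsqrtr //; apply: ler_sum => i _.
have -> : (C *m v) i 0 = dotv (row i C)^T v.
  by rewrite mxE; apply: eq_bigr => j _; rewrite !mxE.
have := cauchy_schwarz (row i C)^T v.
have := cauchy_schwarz (- (row i C)^T) v; rewrite dotvNl norm2N.
have := norm2_ge0 v; have := norm2_ge0 (row i C)^T.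
move: (dotv _ _) (norm2 _) (norm2 v) v_le1 => p x y *.
have : x * y <= x by nra.
nra.
Qed.

Lemma opnorm2_ge0 (R : realType) m n (C : 'M[R]_(m, n)) : 0 <= opnorm2 C.
Proof.
apply: (ub_le_sup (opnorm2_has_ubound C)).
by exists 0; rewrite /= ?mulmx0 norm20 ?ler01.
Qed.

Lemma norm2_mulmx (R : realType) m n (C : 'M[R]_(m, n)) (v : 'cV[R]_n) :
  norm2 (C *m v) <= opnorm2 C * norm2 v.
Proof.
have [->|v_neq0] := eqVneq v 0; first by rewrite mulmx0 !norm20 mulr0.
have v_gt0 : 0 < norm2 v by rewrite lt_neqAle eq_sym norm2_eq0 v_neq0 norm2_ge0.
rewrite -ler_pdivrMr //.
apply: (ub_le_sup (opnorm2_has_ubound C)).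
have Vv : `|(norm2 v)^-1| = (norm2 v)^-1 by rewrite ger0_norm // invr_ge0 ltW.
exists ((norm2 v)^-1 *: v) => /=; first by rewrite norm2Z Vv mulVf ?gt_eqF.
by rewrite -scalemxAr norm2Z Vv mulrC.
Qed.

(** * The Rayleigh bound for the smallest eigenvalue *)

(** Cauchy-Schwarz for the semi-inner product <C _, _>, applied to v and C v. *)
Lemma psd_norm2_mulmx (R : realType) n (C : 'M[R]_n) (v : 'cV[R]_n) :
    C^T = C -> (forall w, 0 <= dotv (C *m w) w) ->
  norm2 (C *m v) ^+ 2 <= opnorm2 C * dotv (C *m v) v.
Proof.
move=> Csym Cpsd; have := psd_cauchy_schwarz v (C *m v) Csym Cpsd.
have := cauchy_schwarz (C *m (C *m v)) (C *m v).
have := norm2_mulmx C (C *m v).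
rewrite -norm2_sqr; have := Cpsd v; have := opnorm2_ge0 C.
have := norm2_ge0 (C *m v); rewrite le_eqVlt => /predU1P[<-|].
  by move=> *; rewrite expr0n mulr_ge0.
move: (norm2 (C *m v)) (dotv (C *m v) v) (opnorm2 C) => x q N.
move: (norm2 _) (dotv _ _) => y r x_gt0 N_ge0 q_ge0 yx rx CS.
have rN : r <= N * x ^+ 2 by nra.
have : x ^+ 2 * x ^+ 2 <= (N * q) * x ^+ 2 by nra.
by rewrite ler_pM2r ?exprn_gt0.
Qed.

(** The infimum mu of the Rayleigh quotient is an eigenvalue: otherwise the
    positive semidefinite matrix T = C - mu would be invertible, hence bounded
    below, and the quadratic form of T would be bounded away from 0 on the unit
    sphere, so mu would not be the infimum. *)
Lemma lambda_min_rayleigh (R : realType) n (C : 'M[R]_n) (h : 'cV[R]_n) :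
  C^T = C -> lambda_min C * norm2 h ^+ 2 <= dotv (C *m h) h.
Proof.
(* For nonzero h the dimension is positive and the unit sphere nonempty. *)
move=> Csym; have [->|h_neq0] := eqVneq h 0.
  by rewrite norm2_sqr !dotv0 mulr0.
pose E := [set dotv (C *m v) v | v in [set v : 'cV[R]_n | norm2 v = 1]].
pose mu := inf E.
have normalize (v : 'cV[R]_n) : v != 0 -> norm2 ((norm2 v)^-1 *: v) = 1.
  move=> v0; have v_neq0 : norm2 v != 0 by rewrite norm2_eq0.
  by rewrite norm2Z ger0_norm ?invr_ge0 ?norm2_ge0 // mulVf.
have E_neq0 : E !=set0.
  by eexists; exists ((norm2 h)^-1 *: h); [exact: normalize|].
have E_lb : has_lbound E.
  exists (- opnorm2 C) => _ [v /= v1 <-].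
  have := cauchy_schwarz (- (C *m v)) v; rewrite dotvNl norm2N.
  by have := norm2_mulmx C v; rewrite v1; lra.
have mu_le v : mu * norm2 v ^+ 2 <= dotv (C *m v) v.
  have [->|v_neq0] := eqVneq v 0.
    by rewrite norm2_sqr !dotv0 mulr0.
  have : mu <= dotv (C *m ((norm2 v)^-1 *: v)) ((norm2 v)^-1 *: v).
    by apply: ge_inf E_lb _ _; exists ((norm2 v)^-1 *: v); first exact: normalize.
  have v_gt0 : 0 < norm2 v.
    by rewrite lt_neqAle eq_sym norm2_eq0 v_neq0 norm2_ge0.
  rewrite -scalemxAr !dotv_lin mulrA -invfM -expr2 mulrC.
  by rewrite ler_pdivlMr ?exprn_gt0.
pose T := C - mu%:M.
have dotT v : dotv (T *m v) v = dotv (C *m v) v - mu * norm2 v ^+ 2.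
  by rewrite mulmxBl mul_scalar_mx !dotv_lin norm2_sqr.
have Tpsd v : 0 <= dotv (T *m v) v by rewrite dotT subr_ge0.
have Tsym : T^T = T by rewrite linearB /= Csym tr_scalar_mx.
have Tsing : T \notin unitmx.
  apply/negP => Tunit.
  pose G := opnorm2 (invmx T) ^+ 2 * opnorm2 T.
  (* |v| <= |T^-1| |T v| combined with |T v|^2 <= |T| <T v, v>. *)
  have G_ge v : norm2 v = 1 -> 1 <= G * (dotv (C *m v) v - mu).
    move=> v1; have := norm2_mulmx (invmx T) (T *m v).
    rewrite mulmxA mulVmx // mul1mx v1.
    have := psd_norm2_mulmx v Tsym Tpsd; rewrite dotT v1 expr1n mulr1 /G.
    have := norm2_ge0 (T *m v); have := opnorm2_ge0 (invmx T).
    move: (norm2 _) (opnorm2 _) (opnorm2 T) (_ - _) => x g N q.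
    move=> g_ge0 x_ge0 xNq gx.
    have : 1 <= (g * x) ^+ 2 by rewrite expr_ge1 // mulr_ge0.
    rewrite exprMn => /le_trans; apply; rewrite -mulrA.
    by rewrite ler_wpM2l ?sqr_ge0.
  have G_gt0 : 0 < G.
    have := G_ge _ (normalize h h_neq0).
    have : 0 <= G by rewrite mulr_ge0 ?sqr_ge0 ?opnorm2_ge0.
    rewrite le_eqVlt => /predU1P[<-|//]; rewrite mul0r; lra.
  have : mu + G^-1 <= mu.
    apply: lb_le_inf E_neq0 _ => _ [v /= v1 <-].
    by rewrite -lerBrDl -[G^-1]mul1r ler_pdivrMr // mulrC G_ge.
  by have := G_gt0; rewrite -invr_gt0; lra.
apply: le_trans (mu_le h); rewrite ler_wpM2r ?sqr_ge0 //.
(* It remains that mu is an eigenvalue and that eigenvalues are bounded below. *)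
apply: ge_inf => /=; last first.
  by rewrite /eigenvalue /eigenspace kermx_eq0 row_free_unit.
exists mu => l /= /eigenvalueP[w wC w_neq0].
have wT_neq0 : w^T != 0 by rewrite trmx_eq0.
have wT_gt0 : 0 < norm2 w^T ^+ 2.
  by rewrite exprn_gt0 // lt_neqAle eq_sym norm2_eq0 wT_neq0 norm2_ge0.
rewrite -(ler_pM2r wT_gt0); apply: le_trans (mu_le _) _.
by rewrite -{1}Csym -trmx_mul wC linearZ /= dotvZl norm2_sqr.
Qed.

Lemma dotv_symmx (R : realType) n (C : 'M[R]_n) (h : 'cV[R]_n) :
  dotv (symmx C *m h) h = dotv (C *m h) h.
Proof.
rewrite -scalemxAl mulmxDl !dotv_lin (dotv_trmx C^T) trmxK (dotvC h).
by field.
Qed.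

Lemma lambda_min_symmx (R : realType) n (C : 'M[R]_n) (h : 'cV[R]_n) :
  lambda_min (symmx C) * norm2 h ^+ 2 <= dotv (C *m h) h.
Proof.
rewrite -dotv_symmx; apply: lambda_min_rayleigh.
by rewrite /symmx linearZ /= linearD /= trmxK addrC.
Qed.

(** * Projection onto the constraint set *)

(** In coordinates the set is a closed subset of a product of segments, which
    is compact, and the squared distance to z is a continuous function. *)
Lemma box_affine_proj_exists (R : realType) m n (M : 'M[R]_(m, n)) d c
    (z : 'cV[R]_n) :
  box_affine_set M d c !=set0 -> exists p, is_proj (box_affine_set M d c) z p.
Proof.
move=> [u0 [Mu0 u0c]]; pose T := prod_topology (fun _ : 'I_n => R).
pose K : set T := [set f | forall i, `[0, c i 0]%classic (f i)] `&`
  \bigcap_(i in [set: 'I_m]) [set f | \sum_j M i j * f j = d i 0].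
have coord_cts (i : 'I_n) : continuous (fun f : T => f i).
  exact: (@proj_continuous _ (fun _ : 'I_n => R) i).
have cst_cts (k : R) : continuous (fun _ : T => k).
  exact: (@cst_continuous T R k).
have sum_cts (F : 'I_n -> T -> R) :
    (forall i, continuous (F i)) -> continuous (fun f => \sum_i F i f).
  by move=> Fc; apply: continuous_big => //; exact: add_continuous.
have Kcompact : compact K.
  apply: compact_closedI.
    apply: (@tychonoff _ (fun _ : 'I_n => R) (fun i => `[0, c i 0]%classic)).
    by move=> i; exact: segment_compact.
  apply: closed_bigI => i _.
  have : continuous (fun f : T => \sum_j M i j * f j).
    apply: sum_cts => j f.
    exact: (@continuousM _ T _ _ f (cst_cts (M i j) f) (coord_cts j f)).
  by move=> /continuous_closedP/(_ _ (@closed_eq R (d i 0))).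
have colK f : K f -> box_affine_set M d c (\col_i f i).
  move=> [fc Mf]; split => [|i]; last by have := fc i; rewrite mxE /= in_itv.
  apply/colP => i; rewrite mxE -(Mf i I).
  by apply: eq_bigr => j _; rewrite mxE.
have Kcol u : box_affine_set M d c u -> K (fun i => u i 0).
  move=> [Mu uc]; split => [i|i _] /=; first by rewrite in_itv /= uc.
  by rewrite -Mu mxE.
pose dist2 (f : T) : R := \sum_i (z i 0 - f i) * (z i 0 - f i).
have dist2E (u : 'cV[R]_n) : dist2 (fun i => u i 0) = dotv (z - u) (z - u).
  by apply: eq_bigr => i _; rewrite !mxE.
have dist2_cts : continuous dist2.
  apply: sum_cts => i f.
  have diff_cts : {for f, continuous (fun f : T => z i 0 - f i)}.
    exact: (@continuousB _ _ T _ _ f (cst_cts (z i 0) f) (coord_cts i f)).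
  exact: (@continuousM _ T _ _ f diff_cts diff_cts).
have K_neq0 : K !=set0 by exists (fun i => u0 i 0); exact: Kcol.
have [f fK fmin] :=
  @compact_EVT_min T R dist2 K K_neq0 Kcompact (continuous_subspaceT dist2_cts).
exists (\col_i f i); split; first by apply: colK; rewrite inE in fK.
move=> q Kq; rewrite ler_wsqrtr // -!dist2E.
have -> : (fun i => (\col_j f j) i 0) = f :> T by apply/funext => i; rewrite mxE.
by apply: fmin; rewrite inE; exact: Kcol.
Qed.

Lemma box_affine_convex (R : realType) m n (M : 'M[R]_(m, n)) d c
    (p q : 'cV[R]_n) (t : R) :
    box_affine_set M d c p -> box_affine_set M d c q -> 0 <= t <= 1 ->
  box_affine_set M d c (p + t *: (q - p)).
Proof.
move=> [Mp pc] [Mq qc] /andP[t0 t1]; split.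
  by rewrite mulmxDr -scalemxAr mulmxBr Mp Mq subrr scaler0 addr0.
by move=> i; rewrite !mxE; have := pc i; have := qc i; nra.
Qed.

(** Moving from p towards q by a step t changes the squared distance to z by
    - 2 t <z - p, q - p> + t^2 |q - p|^2, which is negative for small t > 0 when
    the inner product is positive. *)
Lemma proj_variational (R : realType) n (K : set 'cV[R]_n) (z p q : 'cV[R]_n) :
    (forall t, 0 <= t <= 1 -> K (p + t *: (q - p))) -> is_proj K z p ->
  dotv (z - p) (q - p) <= 0.
Proof.
move=> Kseg [_ pmin]; rewrite leNgt; apply/negP => s_gt0.
have D_ge0 := dotv_ge0 (q - p).
(* This t is in ]0, 1], and t |q - p|^2 < 2 <z - p, q - p>. *)
pose t := dotv (z - p) (q - p) / (dotv (z - p) (q - p) + dotv (q - p) (q - p)).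
have sD_gt0 : 0 < dotv (z - p) (q - p) + dotv (q - p) (q - p) by lra.
have t_gt0 : 0 < t by rewrite divr_gt0.
have t_le1 : t <= 1 by rewrite ler_pdivrMr // mul1r; lra.
have := pmin _ (Kseg t _); rewrite (ltW t_gt0) t_le1 => /(_ isT).
rewrite -(@ler_pXn2r _ 2) ?nnegrE ?norm2_ge0 // !norm2_sqr.
have -> : z - (p + t *: (q - p)) = (z - p) - t *: (q - p).
  by rewrite opprD addrA.
have tE : t * (dotv (z - p) (q - p) + dotv (q - p) (q - p))
          = dotv (z - p) (q - p) by rewrite divfK ?gt_eqF.
move: (z - p) (q - p) (t) s_gt0 D_ge0 t_gt0 tE => w e s {t t_le1 sD_gt0}.
have -> : dotv (w - s *: e) (w - s *: e)
          = dotv w w - 2 * s * dotv w e + s ^+ 2 * dotv e e.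
  by rewrite !dotv_lin (dotvC e w); ring.
nra.
Qed.

(** Adding the variational inequalities of the two projected points. *)
Lemma proj_firmly_nonexpansive (R : realType) m n (M : 'M[R]_(m, n)) d c
    (y z : 'cV[R]_n) :
  let P := Defs.proj (box_affine_set M d c) in
  box_affine_set M d c !=set0 ->
  dotv (P y - P z) (P y - P z) <= dotv (P y - P z) (y - z).
Proof.
move=> P K_neq0.
have projP x : is_proj (box_affine_set M d c) x (P x).
  by apply: (xgetPex 0); exact: box_affine_proj_exists.
have vi x x' : dotv (x - P x) (P x' - P x) <= 0.
  apply: (proj_variational _ (projP x)) => t t01.
  by apply: box_affine_convex t01; [case: (projP x)|case: (projP x')].
have := lerD (vi y z) (vi z y); rewrite addr0.
rewrite !dotv_lin (dotvC y (P y)) (dotvC y (P z)) (dotvC z (P y)).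
rewrite (dotvC z (P z)) (dotvC (P z) (P y)); lra.
Qed.

(** * Properties of the residual *)

Lemma firm_norm2_le (R : realType) n (p w : 'cV[R]_n) :
  dotv p p <= dotv p w -> norm2 p <= norm2 w.
Proof.
rewrite -norm2_sqr expr2 => /le_trans/(_ (cauchy_schwarz p w)).
have [->|p_neq0] := eqVneq (norm2 p) 0; first by rewrite norm2_ge0.
by rewrite ler_pM2l // lt_neqAle eq_sym p_neq0 norm2_ge0.
Qed.

(** The hypothesis says that p lies in the ball with diameter [0, w], that is
    |2 p - w| <= |w|. Splitting 2 p as w + (2 p - w) then gives the bound. *)
Lemma firm_dotv_le (R : realType) n (p w h : 'cV[R]_n) :
  dotv p p <= dotv p w -> 2 * dotv p h <= dotv w h + norm2 w * norm2 h.
Proof.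
move=> firm.
have reflect_le : norm2 (2 *: p - w) <= norm2 w.
  by rewrite ler_wsqrtr // !dotv_lin (dotvC w p); lra.
have := le_trans (cauchy_schwarz (2 *: p - w) h)
                 (ler_wpM2r (norm2_ge0 h) reflect_le).
by rewrite !dotv_lin; lra.
Qed.

Lemma residualB (R : realType) n (A B : 'M[R]_n) a b eta (K : set 'cV[R]_n)
    (x y : 'cV[R]_n) :
  let z u := (A - eta *: B) *m u + a - eta *: b in
  (residual A B a b eta K x - residual A B a b eta K y
     = A *m (x - y) - (Defs.proj K (z x) - Defs.proj K (z y)))
  * (z x - z y = (A - eta *: B) *m (x - y)).
Proof.
rewrite /residual /= !(mulmxBr _ x y); split.
  by apply/matrixP => i j; rewrite !mxE; ring.
by apply/matrixP => i j; rewrite !mxE; ring.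
Qed.

Lemma residual_lipschitz (R : realType) n m (A B : 'M[R]_n) a b eta
    (M : 'M[R]_(m, n)) d c (x y : 'cV[R]_n) :
  let F := residual A B a b eta (box_affine_set M d c) in
  box_affine_set M d c !=set0 ->
  norm2 (F x - F y)
    <= (opnorm2 A + opnorm2 (A - eta *: B)) * norm2 (x - y).
Proof.
move=> F K_neq0; rewrite /F.
have := residualB A B a b eta (box_affine_set M d c) x y.
set z := fun u => _; case=> -> zE.
have := proj_firmly_nonexpansive (z x) (z y) K_neq0.
rewrite /= zE; set h := x - y; set p := _ - _ => firm.
apply: le_trans (norm2_triangle _ _) _; rewrite norm2N mulrDl.
apply: lerD; first exact: norm2_mulmx.
by apply: le_trans (norm2_mulmx _ _); exact: firm_norm2_le.
Qed.

(** Write h = x - y, w = (A - eta B) h and p for the increment of the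
    projection. The bound <p, h> <= (<w, h> + |w| |h|) / 2 subtracts only half of
    w, and A h - w / 2 = (A + eta B) h / 2 remains. Using only that the projection
    is nonexpansive would give <A h, h> - |w| |h| instead, which does not involve
    the symmetric part of A + eta B. *)
Lemma residual_monotone (R : realType) n m (A B : 'M[R]_n) a b eta
    (M : 'M[R]_(m, n)) d c (x y : 'cV[R]_n) :
  let F := residual A B a b eta (box_affine_set M d c) in
  box_affine_set M d c !=set0 ->
  2^-1 * (lambda_min (symmx (A + eta *: B)) - opnorm2 (A - eta *: B))
      * norm2 (x - y) ^+ 2
    <= dotv (F x - F y) (x - y).
Proof.
move=> F K_neq0; rewrite /F.
have := residualB A B a b eta (box_affine_set M d c) x y.
set z := fun u => _; case=> -> zE.
have := proj_firmly_nonexpansive (z x) (z y) K_neq0.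
rewrite /= {}zE; move: (Defs.proj _ _ - _) (x - y) => p h.
move=> /(firm_dotv_le h) ph_le.
have wh_le : norm2 ((A - eta *: B) *m h) * norm2 h
             <= opnorm2 (A - eta *: B) * norm2 h ^+ 2.
  by rewrite expr2 mulrA ler_wpM2r ?norm2_ge0 ?norm2_mulmx.
have := lambda_min_symmx (A + eta *: B) h.
have : dotv ((A - eta *: B) *m h) h + dotv ((A + eta *: B) *m h) h
       = 2 * dotv (A *m h) h.
  by rewrite mulmxBl mulmxDl !dotvDl dotvNl; ring.
rewrite dotvDl dotvNl; move: ph_le wh_le; lra.
Qed.

Theorem mainTheorem4 (R : realType) (n m : nat) (A B : 'M[R]_n)
    (a b : 'cV[R]_n) (eta : R) (M : 'M[R]_(m, n)) (d : 'cV[R]_m)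
    (c : 'cV[R]_n)
    (eta_gt0 : 0 < eta)
    (K_neq0 : box_affine_set M d c !=set0) :
  let K := box_affine_set M d c in
  let Reta := residual A B a b eta K in
  let lmin := lambda_min (symmx (A + eta *: B)) in
  let L_R := opnorm2 A + opnorm2 (A - eta *: B) in
  let mu_R := 2^-1 * (lmin - opnorm2 (A - eta *: B)) in
  let beta_R := (lmin - opnorm2 (A - eta *: B)) /
                (2 * (opnorm2 A + opnorm2 (A - eta *: B)) ^+ 2) in
  (forall x y : 'cV[R]_n, norm2 (Reta x - Reta y) <= L_R * norm2 (x - y)) /\
  ((forall x y : 'cV[R]_n,
      mu_R * norm2 (x - y) ^+ 2 <= dotv (Reta x - Reta y) (x - y)) /\
   (opnorm2 (A - eta *: B) <= lmin -> monotone_map Reta)) /\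
  (opnorm2 (A - eta *: B) < lmin ->
    [/\ 0 < mu_R,
        strongly_monotone_map Reta,
        (forall x y : 'cV[R]_n,
           mu_R / L_R ^+ 2 * norm2 (Reta x - Reta y) ^+ 2
           <= dotv (Reta x - Reta y) (x - y)) &
        ([set x | Reta x = 0] !=set0 -> closed [set x | Reta x = 0] ->
         exists xs : 'cV[R]_n,
           [/\ Reta xs = 0,
               (forall y : 'cV[R]_n, Reta y = 0 -> y = xs),
               (forall x : 'cV[R]_n,
                  mu_R * norm2 (x - xs) ^+ 2 <= dotv (Reta x) (x - xs)) &
               (forall x : 'cV[R]_n,
                  beta_R * norm2 (Reta x) ^+ 2 <= dotv (Reta x) (x - xs))])]).
Proof.
move=> K Reta lmin L_R mu_R beta_R.
have lip x y : norm2 (Reta x - Reta y) <= L_R * norm2 (x - y).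
  exact: residual_lipschitz.
have mono x y : mu_R * norm2 (x - y) ^+ 2 <= dotv (Reta x - Reta y) (x - y).
  exact: residual_monotone.
split; [exact: lip|split].
  split=> [|lmin_ge x y]; first exact: mono.
  apply: le_trans (mono x y); apply: mulr_ge0; last exact: sqr_ge0.
  by apply: mulr_ge0; rewrite ?invr_ge0 ?subr_ge0.
move=> lmin_gt; have mu_gt0 : 0 < mu_R.
  by apply: mulr_gt0; rewrite ?invr_gt0 ?subr_gt0.
have L_ge0 : 0 <= L_R by apply: addr_ge0; exact: opnorm2_ge0.
have coco x y : mu_R / L_R ^+ 2 * norm2 (Reta x - Reta y) ^+ 2
                <= dotv (Reta x - Reta y) (x - y).
  apply: le_trans (mono x y); rewrite -mulrA ler_pM2l //.
  (* When L_R = 0 the quotient is 0 by convention and the bound is trivial. *)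
  have [->|L_neq0] := eqVneq L_R 0; first by rewrite expr0n invr0 mul0r sqr_ge0.
  have L_gt0 : 0 < L_R by rewrite lt_neqAle eq_sym L_neq0.
  rewrite mulrC ler_pdivrMr ?exprn_gt0 // -exprMn (mulrC (norm2 (x - y))).
  by rewrite ler_pXn2r ?nnegrE ?norm2_ge0 // mulr_ge0 ?norm2_ge0.
split=> //; first by exists mu_R.
move=> [xs /= xs0] _; exists xs; split=> //.
- move=> y y0; have := mono y xs; rewrite y0 xs0 subrr dotvC dotv0.
  rewrite pmulr_rle0 // => yxs; apply/eqP; rewrite -subr_eq0 -norm2_eq0.
  by rewrite -sqrf_eq0 eq_le yxs sqr_ge0.
- by move=> x; have := mono x xs; rewrite xs0 subr0.
have betaE : beta_R = mu_R / L_R ^+ 2.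
  by rewrite /beta_R /mu_R invfM mulrA (mulrC _ 2^-1).
by move=> x; have := coco x xs; rewrite xs0 subr0 betaE.
Qed.
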